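(* Let $\mathcal{C}$ be a clutter with a perfect matching $e_1,\ldots,e_g$ of König type and let $I=I(\mathcal{C})$ be its edge ideal. Then the following conditions are equivalent: (a) $\mathcal{C}$ is unmixed. (b) For any two edges $e\neq e'$ of $\mathcal{C}$ and for any two distinct vertices $x\in e$, $y\in e'$ both contained in some $e_i$, the set $(e\setminus\{x\})\cup(e'\setminus\{y\})$ contains an edge of $\mathcal{C}$. (c) For any two edges $e\neq e'$ of $\mathcal{C}$ and for any $T\subset e_i$ (for any $i$) such that $x_T$ divides $x_ex_{e'}$, the set ${\rm supp}(x_ex_{e'}/x_T)$ contains an edge of $\mathcal{C}$. (d) For any two edges $e\neq e'$ of $\mathcal{C}$ and for any $e_i$, one has $(x_ex_{e'}\colon x_{e_i})\subset I$. (e) $I=(I^2\colon x_{e_1})+\cdots+(I^2\colon x_{e_g})$.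
   Context: A clutter $\mathcal{C}$ with finite vertex set $X=\{x_1,\ldots,x_n\}$ is a family $E(\mathcal{C})$ of subsets of $X$, called edges, none of which is included in another. Let $R=K[x_1,\ldots,x_n]$ be a polynomial ring over a field $K$. For $e\subset X$ put $x_e=\prod_{x_i\in e}x_i$. The edge ideal of $\mathcal{C}$ is $I(\mathcal{C})=(x_e : e\in E(\mathcal{C}))\subset R$. A subset $C\subset X$ is a vertex cover of $\mathcal{C}$ if every edge contains at least one vertex of $C$; it is a minimal vertex cover if no proper subset of it is a vertex cover. The height of $I(\mathcal{C})$ equals the minimum number of vertices in a vertex cover of $\mathcal{C}$. $\mathcal{C}$ is unmixed if all its minimal vertex covers have the same number of elements. A perfect matching of König type of $\mathcal{C}$ is a collection $e_1,\ldots,e_g$ of pairwise disjoint edges of $\mathcal{C}$ whose union is $X$ and such that $g$ is the height of $I(\mathcal{C})$. The support of a monomial $x^a=x_1^{a_1}\cdots x_n^{a_n}$ is ${\rm supp}(x^a)=\{x_i : a_i>0\}$. For a monomial $m$ and an ideal $J$ of $R$, $(J\colon m)=\{f\in R : fm\in J\}$; $(m'\colon m)$ denotes $((m')\colon m)$ where $(m')$ is the principal ideal generated by $m'$. *)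

(* Defs.v *)
From mathcomp Require Import all_boot all_order all_algebra.
From mathcomp Require Import ring_quotient.
From mathcomp Require Import boolp classical_sets.
From mathcomp Require Import mpoly.

Set Implicit Arguments.
Unset Strict Implicit.
Unset Printing Implicit Defensive.

Import GRing.Theory.

Local Open Scope ring_scope.
Local Open Scope classical_set_scope.

(* Ideals are Prop-valued subsets [set R] of the ring, so that no membership
   test is required of them; [idealr_closed] and [prime_idealr_closed] are
   applied to them through the classical boolean membership [\in]. *)

Section Ideals.
Variable R : comNzRingType.
Implicit Types (S I J P : set R) (m : R).

Definition ideal_span S : set R :=
  [set f | exists s : seq (R * R),
     (forall p, p \in s -> S p.2) /\ f = \sum_(p <- s) p.1 * p.2].

Definition ideal_mul I J : set R :=
  ideal_span [set f | exists a b, [/\ I a, J b & f = a * b]].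

Definition ideal_colon I m : set R := [set f | I (f * m)].

Definition ideal_sum (g : nat) (J : 'I_g -> set R) : set R :=
  [set f | exists h : 'I_g -> R, (forall i, J i (h i)) /\ f = \sum_i h i].

(* [idealr_closed] includes properness. *)
Definition prime_ideal P : Prop :=
  idealr_closed [pred x in P] /\ prime_idealr_closed [pred x in P].

Definition prime_chain P (k : nat) : Prop :=
  exists Q : nat -> set R,
    [/\ forall i, (i <= k)%N -> prime_ideal (Q i),
        forall i, (i < k)%N -> Q i `<` Q i.+1
      & Q k = P].

Definition prime_height P (h : nat) : Prop :=
  prime_chain P h /\ (forall k, prime_chain P k -> (k <= h)%N).

(* The height as a relation: a prime with arbitrarily long chains below it has
   no [prime_height], and the unit ideal has no [ideal_height]. *)
Definition ideal_height I (h : nat) : Prop :=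
  (exists P, [/\ prime_ideal P, I `<=` P & prime_height P h]) /\
  (forall P k, prime_ideal P -> I `<=` P -> prime_height P k -> (h <= k)%N).

End Ideals.

(* The vertices x_1, ..., x_n are the elements of 'I_n; a clutter is given by
   its set of edges. *)

Section Clutters.
Variable n : nat.
Implicit Types (C E : {set {set 'I_n}}) (e A : {set 'I_n}).

Definition is_clutter C : Prop :=
  {in C &, forall e e', e \subset e' -> e = e'}.

Definition vertex_cover C A : bool := [forall e in C, e :&: A != finset.set0].

Definition min_vertex_cover C A : bool := minset (vertex_cover C) A.

Definition unmixed C : Prop :=
  forall A B, min_vertex_cover C A -> min_vertex_cover C B -> #|A| = #|B|.

Definition contains_edge C A : Prop := exists2 e, e \in C & e \subset A.

(* Exponent vector of the squarefree monomial x_e, see [xsetE]. Divisibility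
   and quotient of monomials are [<=] and [-] on exponents; [-] is truncated,
   so it is only meaningful under divisibility. *)
Definition mset e : 'X_{1..n} := [multinom (i \in e : nat) | i < n].

Definition msupport (a : 'X_{1..n}) : {set 'I_n} := [set i | 0 < a i]%N%SET.

End Clutters.

Section EdgeIdeal.
Variables (K : fieldType) (n : nat).
Implicit Types (C : {set {set 'I_n}}) (e : {set 'I_n}).

Definition xset e : {mpoly K[n]} := \prod_(i in e) 'X_i.

Lemma xsetE e : xset e = 'X_[mset e].
Proof.
rewrite [RHS]mpolyXE_id /xset [LHS]big_mkcond /=.
by apply: eq_bigr => i _; rewrite mnmE; case: (i \in e); rewrite ?expr1 ?expr0.
Qed.

Definition edge_ideal C : set {mpoly K[n]} :=
  ideal_span [set f | exists2 e, e \in C & f = xset e].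

Definition konig_perfect_matching C (g : nat) (e : 'I_g -> {set 'I_n}) : Prop :=
  [/\ forall i, e i \in C,
      forall i j, i != j -> e i :&: e j = finset.set0,
      (\bigcup_(i < g) e i)%SET = [set: 'I_n]%SET
    & ideal_height (edge_ideal C) g].

End EdgeIdeal.

Arguments edge_ideal K {n} C.
Arguments xset K {n} e.
Arguments konig_perfect_matching K {n} C {g} e.

(* Main.v *)
Require Import Defs.
From mathcomp Require Import all_boot all_order all_algebra.
From mathcomp Require Import boolp classical_sets.
From mathcomp Require Import mpoly.

Set Implicit Arguments.
Unset Strict Implicit.
Unset Printing Implicit Defensive.

Import GRing.Theory.

(** The edges [m i] of the matching partition the vertices, so a vertex cover
    has at least [g] elements, and it has exactly [g] if and only if it meets
    each [m i] in a single vertex. All five conditions are proved equivalent to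
    the condition [transversal]: every minimal cover meets each [m i] in a
    single vertex.

    That [transversal] implies (a) is this count. The converse needs a cover
    with at most [g] vertices, and the height of the edge ideal provides it
    ([height_vertex_cover]). Such a cover is read off
    a prime [P] of height [g] above the ideal: the variables in [P] form a cover
    since [P] is prime, and the primes generated by initial segments of these
    variables make a chain below [P], so there are at most [g] of them.

    Two facts on a minimal cover [B] link [transversal] to the other conditions.
    A set that contains no edge is avoided by some [B]
    ([contains_edgeNP]); applied to the sets of (b) and (c), this gives a cover
    with two vertices in one [m i]. Conversely, for each [x] in [B] some edge
    meets [B] only in [x] ([min_cover_private_edge]); if [B] has two vertices
    [x], [y] in [m i], the private edges [e], [e'] of [x] and [y] violate (b),
    and the monomial [x_e x_e' / x_(m i)], read with truncated exponents,
    violates (e).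

    The steps from (c) to (d) and from (d) to (e) are computations with
    exponents: all ideals involved are spanned by monomials, and membership in
    them is decided monomial by monomial ([monomial_idealP]). *)

Local Open Scope ring_scope.

(** * Ideals spanned by monomials *)

Section IdealSpan.
Variable R : comNzRingType.
Implicit Types (G J : set R) (f h a : R).

Lemma ideal_span_gen G f : G f -> ideal_span G f.
Proof.
move=> Gf; exists [:: (1, f)]; split; last by rewrite big_seq1 mul1r.
by move=> p; rewrite inE => /eqP->.
Qed.

Lemma ideal_span0 G : ideal_span G 0.
Proof. by exists [::]; rewrite big_nil; split. Qed.

Lemma ideal_spanD G f h : ideal_span G f -> ideal_span G h ->
  ideal_span G (f + h).
Proof.
move=> [s [Gs ->]] [t [Gt ->]]; exists (s ++ t); rewrite big_cat; split=> // p.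
by rewrite mem_cat => /orP[/Gs|/Gt].
Qed.

Lemma ideal_spanMl G a f : ideal_span G f -> ideal_span G (a * f).
Proof.
move=> [s [Gs ->]]; exists [seq (a * p.1, p.2) | p <- s]; split.
  by move=> p /mapP[q /Gs Gq ->].
by rewrite big_map mulr_sumr; apply: eq_bigr => p _ /=; rewrite mulrA.
Qed.

Lemma ideal_span_sub G J : J 0 -> (forall f h, J f -> J h -> J (f + h)) ->
  (forall a f, G f -> J (a * f)) -> (ideal_span G `<=` J)%classic.
Proof.
move=> J0 JD JM f [s [Gs ->]].
by rewrite big_seq; apply: big_ind => // p /Gs; apply: JM.
Qed.

Lemma ideal_sum_gen g (J : 'I_g -> set R) i f :
  (forall j, J j 0) -> J i f -> ideal_sum J f.
Proof.
move=> J0 Jf; exists (fun j => if j == i then f else 0); split.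
  by move=> j; case: eqP => [->|].
by rewrite -big_mkcond big_pred1_eq.
Qed.

End IdealSpan.

Section MonomialIdeals.
Variables (K : fieldType) (n : nat).
Implicit Types (S : set 'X_{1..n}) (f : {mpoly K[n]}) (C : {set {set 'I_n}}).
Implicit Types (A e : {set 'I_n}) (u v s : 'X_{1..n}).

(** Multiplication only raises exponents and addition creates no new monomials,
    so an ideal spanned by monomials is seen on the supports of its elements.
    Every ideal of the theorem is of this kind, which turns the algebraic
    conditions into statements about exponents. *)
Lemma monomial_idealP S f :
  ideal_span [set ('X_[s] : {mpoly K[n]}) | s in S]%classic f <->
  (forall u, u \in msupp f -> exists2 s, S s & (s <= u)%MM).
Proof.
split=> [|supf].
  move: f; apply: ideal_span_sub => [u | f h fP hP u | a f [s Ss <-] u].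
  - by rewrite -mpolyC0 msupp0.
  - by move/msuppD_le; rewrite mem_cat => /orP[/fP|/hP].
  - move=> /msuppM_le /allpairsP[[v w] /= [_]].
    rewrite msuppX inE => /eqP-> ->.
    by exists s => //; apply/mnm_lepP => i; rewrite mnmDE leq_addl.
rewrite (mpolyE f) big_seq; apply: big_ind => [|p q|u /supf[s Ss le_su]].
- exact: ideal_span0.
- exact: ideal_spanD.
rewrite -(submK le_su) mpolyXD -mul_mpolyC mulrA.
by apply/ideal_spanMl/ideal_span_gen; exists s.
Qed.

Lemma mset_le A u : (mset A <= u)%MM = (A \subset msupport u).
Proof.
apply/mnm_lepP/fintype.subsetP => [le_Au i iA | sAu i].
  by have := le_Au i; rewrite mnmE iA inE.
by rewrite mnmE; case iA: (i \in A) => //; have := sAu i iA; rewrite inE.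
Qed.

Lemma edge_idealP C f :
  edge_ideal K C f <->
  (forall u, u \in msupp f -> contains_edge C (msupport u)).
Proof.
rewrite /edge_ideal.
have -> : [set f | exists2 e, e \in C & f = xset K e]%classic =
    [set 'X_[s] | s in [set mset e | e in [set e | e \in C]]]%classic.
  apply/seteqP; split=> [h [e eC ->]|h [_ [e eC <-] <-]].
    by exists (mset e); [exists e|rewrite xsetE].
  by exists e; rewrite ?xsetE.
rewrite monomial_idealP; split=> supf u /supf.
  by move=> [_ [e eC <-]]; rewrite mset_le; exists e.
by move=> [e eC seu]; exists (mset e); [exists e | rewrite mset_le].
Qed.

Lemma edge_idealX C u :
  edge_ideal K C 'X_[u] <-> contains_edge C (msupport u).
Proof.
rewrite edge_idealP; split=> [|Cu v]; first by apply; rewrite msuppX inE.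
by rewrite msuppX inE => /eqP->.
Qed.

Lemma edge_ideal_sqrP C f :
  ideal_mul (edge_ideal K C) (edge_ideal K C) f <->
  (forall u, u \in msupp f -> exists e e',
     [/\ e \in C, e' \in C & (mset e + mset e' <= u)%MM]).
Proof.
split=> [|supf].
  move: f; apply: ideal_span_sub => [u | f h fP hP u | a _ [b [c [Ib Ic ->]]] u].
  - by rewrite -mpolyC0 msupp0.
  - by move/msuppD_le; rewrite mem_cat => /orP[/fP|/hP].
  rewrite mulrA => /msuppM_le /allpairsP[[v w] /= [vab wc ->]].
  have /edge_idealP/(_ v vab)[e eC] := ideal_spanMl a Ib.
  move/edge_idealP/(_ w wc): Ic => [e' e'C].
  rewrite -!mset_le => /mnm_lepP le' /mnm_lepP le; exists e, e'; split=> //.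
  by apply/mnm_lepP => i; rewrite !mnmDE leq_add.
rewrite (mpolyE f) big_seq; apply: big_ind => [|p q|u].
- exact: ideal_span0.
- exact: ideal_spanD.
move=> /supf[e [e' [eC e'C le_u]]].
rewrite -(submK le_u) mpolyXD -mul_mpolyC mulrA.
apply/ideal_spanMl/ideal_span_gen; exists (xset K e), (xset K e').
by rewrite !xsetE mpolyXD; split=> //; apply/edge_idealX; rewrite -?xsetE;
   [exists e | exists e'] => //; rewrite -mset_le; apply: lepm_refl.
Qed.

Lemma principal_monomialX s u :
  ideal_span [set 'X_[s] : {mpoly K[n]}]%classic 'X_[u] <-> (s <= u)%MM.
Proof.
rewrite -(image_set1 (fun s => 'X_[s] : {mpoly K[n]})) monomial_idealP.
split=> [/(_ u)|le_su v].
  by rewrite msuppX inE eqxx => /(_ isT)[_ ->].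
by rewrite msuppX inE => /eqP->; exists s.
Qed.

Lemma msupp_mulX f s u : u \in msupp f -> (s + u)%MM \in msupp (f * 'X_[s]).
Proof. by rewrite !mcoeff_msupp mcoeffMX. Qed.

End MonomialIdeals.

(** * A small vertex cover from the height *)

Section PrimeIdeals.
Variable R : comNzRingType.
Implicit Types (P : set R).

Lemma prime_idealP P : prime_ideal P <->
  [/\ P 0, ~ P 1, forall a u v, P u -> P v -> P (a * u + v)
    & forall u v, P (u * v) -> P u \/ P v].
Proof.
split=> [[[P0 P1 PM] Pp] | [P0 P1 PM Pp]]; split.
- by move/set_mem: P0.
- by move/negP: P1 => P1 H; apply/P1/mem_set.
- by move=> a u v Pu Pv; apply/set_mem/(PM a u v (mem_set Pu) (mem_set Pv)).
- by move=> u v Puv; case/orP: (Pp u v (mem_set Puv)) => /set_mem; [left|right].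
- split.
  + exact/mem_set.
  + by apply/negP => /set_mem /P1.
  + by move=> a u v /set_mem Pu /set_mem Pv; apply/mem_set/PM.
- by move=> u v /set_mem /Pp [] H; apply/orP; [left|right]; apply/mem_set.
Qed.

End PrimeIdeals.

Section VariablePrimes.
Variables (K : fieldType) (n : nat).
Implicit Types (P : set {mpoly K[n]}) (A B : {set 'I_n}).
Implicit Types (C : {set {set 'I_n}}).

Definition kill_vars A (f : {mpoly K[n]}) : {mpoly K[n]} :=
  f \mPo [tuple if i \in A then 0 else 'X_i | i < n].

(** The prime generated by the variables in [A]. As the kernel of a map into a
    domain it is visibly prime. *)
Definition var_prime A : set {mpoly K[n]} := [set f | kill_vars A f = 0]%classic.

Lemma kill_varsXU A i : kill_vars A 'X_i = if i \in A then 0 else 'X_i.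
Proof. by rewrite /kill_vars comp_mpolyXU -tnth_nth tnth_mktuple. Qed.

Lemma prime_var_prime A : prime_ideal (var_prime A).
Proof.
apply/prime_idealP; rewrite /var_prime /kill_vars; split=> /=.
- exact: comp_mpoly0.
- by rewrite comp_mpoly1 => /eqP; rewrite oner_eq0.
- by move=> a u v u0 v0; rewrite comp_mpolyD rmorphM /= u0 v0 mulr0 addr0.
- by move=> u v; rewrite rmorphM /= => /eqP; rewrite mulf_eq0 => /orP[]/eqP;
    [left|right].
Qed.

(** Setting to zero the variables that lie in [P] does not change a polynomial
    modulo [P], hence an element of the kernel is congruent to [0]. *)
Lemma var_prime_sub A P :
  prime_ideal P -> {in A, forall i, P 'X_i} -> (var_prime A `<=` P)%classic.
Proof.
move=> /prime_idealP[P0 _ PM _] PA f f0.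
suff : P (f - kill_vars A f) by rewrite f0 subr0.
have PD u v : P u -> P v -> P (u + v) by move/(PM 1); rewrite mul1r; apply.
have PMl a u : P u -> P (a * u) by move=> Pu; rewrite -[_ * _]addr0; apply: PM.
rewrite {f0}/kill_vars.
set t := [tuple _ | i < n].
have -> : f - (f \mPo t) = \sum_(u <- msupp f) f@_u *: ('X_[u] - ('X_[u] \mPo t)).
  under eq_bigr do rewrite scalerBr -comp_mpolyZ.
  by rewrite sumrB -raddf_sum -mpolyE.
apply: big_ind => // u _.
rewrite -mul_mpolyC; apply: (PMl); rewrite comp_mpolyX.
have [/existsP[i /andP[iA ui]] | /existsPn noA] :=
    boolP [exists i, (i \in A) && (0 < u i)%N].
  rewrite [X in _ - X](bigD1 i) //= tnth_mktuple iA expr0n eqn0Ngt ui /=.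
  rewrite mul0r subr0 mpolyXE_id (bigD1 i) //= mulrC; apply: (PMl).
  by rewrite -(prednK ui) exprS mulrC; apply/PMl/PA.
rewrite mpolyXE_id [X in _ - X](_ : _ = \prod_i 'X_i ^+ u i) ?subrr //.
apply: eq_bigr => i _; rewrite tnth_mktuple.
by case: ifP => // iA; have := noA i; rewrite iA -eqn0Ngt => /eqP ->.
Qed.

(** Adjoining the variables of [P] one at a time gives a strictly increasing
    chain of primes below [P]. *)
Lemma prime_chain_vars P : prime_ideal P ->
  prime_chain P #|[set i | `[< P 'X_i >]]%SET|.
Proof.
move=> primeP; set A := [set i | _]%SET.
have PA i : (i \in A) -> P 'X_i by rewrite inE => /asboolP.
pose pre k : {set 'I_n} := [set i in take k (enum A)]%SET.
have sz : size (enum A) = #|A| by rewrite -cardE.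
have preA k i : i \in pre k -> i \in A.
  by rewrite inE => /mem_take; rewrite mem_enum.
exists (fun k => if (k < #|A|)%N then var_prime (pre k) else P); split.
- by move=> i _; case: ifP => // _; apply: prime_var_prime.
- move=> k ltk; rewrite ltk.
  have /card_gt0P[x0 _] := leq_ltn_trans (leq0n k) ltk.
  pose x := nth x0 (enum A) k.
  have szk : (k < size (enum A))%N by rewrite sz.
  have xA : x \in A by rewrite -mem_enum mem_nth.
  have xk : x \notin pre k.
    have := enum_uniq (mem A); rewrite -(cat_take_drop k (enum A)) cat_uniq.
    case/and3P=> _ /hasPn /(_ x) + _; rewrite (drop_nth x0) // inE eqxx.
    by rewrite [x \in pre k]inE; apply.
  have xk1 : x \in pre k.+1.
    by rewrite inE (take_nth x0) // mem_rcons inE eqxx.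
  have sk : {subset pre k <= pre k.+1}.
    by move=> i; rewrite !inE (take_nth x0) // mem_rcons inE => ->; rewrite orbT.
  have [primeQ QA] :
      let Q := if (k.+1 < #|A|)%N then var_prime (pre k.+1) else P in
      prime_ideal Q /\ {in pre k.+1, forall i, Q 'X_i}.
    case: ifP => _; split; [exact: prime_var_prime | | by [] | by move=> i /preA/PA].
    by move=> i ik; rewrite /var_prime /= kill_varsXU ik.
  split; first by apply: var_prime_sub => // i /sk; apply: QA.
  move=> /(_ _ (QA x xk1)); rewrite /var_prime /= kill_varsXU.
  rewrite (negbTE xk) => /(congr1 (mcoeff U_(x))) /eqP.
  by rewrite mcoeffX eqxx mcoeff0 oner_eq0.
- by rewrite ltnn.
Qed.

Lemma prime_vars_cover C P : prime_ideal P -> (edge_ideal K C `<=` P)%classic ->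
  vertex_cover C [set i | `[< P 'X_i >]]%SET.
Proof.
move=> /prime_idealP[_ P1 _ Pp] subP; apply/forall_inP => e eC.
have : P (xset K e) by apply/subP/ideal_span_gen; exists e.
rewrite /xset; apply: contraPN => /eqP noP.
have {}noP i : i \in e -> ~ P 'X_i.
  by move=> ie Pi; move/setP/(_ i): noP; rewrite !inE ie; move/asboolP: Pi => ->.
apply: (big_ind (fun f => ~ P f)) => // u v Pu Pv /Pp[]//.
Qed.

(** A prime of height [h] above the edge ideal contains at most [h] variables,
    because they yield a chain of primes below it, and these variables form a
    cover. *)
Lemma height_vertex_cover C h : ideal_height (edge_ideal K C) h ->
  exists2 A, vertex_cover C A & (#|A| <= h)%N.
Proof.
move=> [[P [primeP subP [_ maxh]]] _].
exists [set i | `[< P 'X_i >]]%SET; first exact: prime_vars_cover.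
exact/maxh/prime_chain_vars.
Qed.

End VariablePrimes.

(** * Minimal covers and the matching *)

Section Covers.
Variable n : nat.
Implicit Types (C : {set {set 'I_n}}) (A B e : {set 'I_n}).

Lemma min_vertex_cover_sub C A : vertex_cover C A ->
  exists2 B, min_vertex_cover C B & B \subset A.
Proof. by move=> /minset_exists[B]; exists B. Qed.

Lemma min_coverP C B :
  min_vertex_cover C B -> {in C, forall e, e :&: B != finset.set0}.
Proof. by move=> /minsetp /forall_inP. Qed.

(** Removing [x] from a minimal cover uncovers some edge. *)
Lemma min_cover_private_edge C B x : min_vertex_cover C B -> x \in B ->
  exists2 e, e \in C & e :&: B = [set x]%SET.
Proof.
move=> minB xB.
have : ~~ vertex_cover C (B :\ x).
  apply/negP => cov; have := minsetinf minB cov (subD1set B x).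
  by move/setP/(_ x); rewrite !inE eqxx xB.
move=> /forall_inPn[e eC /negPn/eqP eB]; exists e => //; apply/setP => i.
have [j] := set0Pn _ (min_coverP minB eC).
have eBx k : k \in e -> k \in B -> k = x.
  move=> ke kB; apply/eqP; move/setP/(_ k): eB; rewrite !inE ke kB andbT.
  by move/negbFE.
rewrite !inE => /andP[je jB]; apply/andP/eqP => [[ie iB]|->]; first exact: eBx.
by rewrite -(eBx j).
Qed.

(** A set without edges is avoided by some minimal cover, inside its
    complement. *)
Lemma contains_edgeNP C A :
  ~ contains_edge C A -> exists2 B, min_vertex_cover C B & [disjoint A & B].
Proof.
move=> noedge.
have [|B minB sBA] := @min_vertex_cover_sub C (~: A).
  apply/forall_inP => e eC; apply: contra_notN noedge => /eqP eA.
  by exists e => //; rewrite -finset.setD_eq0 finset.setDE eA.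
by exists B => //; rewrite disjoint_sym finset.disjoints_subset.
Qed.

Lemma disjoint_contains_edge C A B :
  min_vertex_cover C B -> [disjoint A & B] -> ~ contains_edge C A.
Proof.
move=> minB AB [e eC seA]; have /set0Pn[i] := min_coverP minB eC.
rewrite inE => /andP[/(fintype.subsetP seA) iA iB].
by rewrite (disjointFr AB iA) in iB.
Qed.

End Covers.

Section Matching.
Variables (n : nat) (C : {set {set 'I_n}}) (g : nat) (m : 'I_g -> {set 'I_n}).
Implicit Types (A B e : {set 'I_n}).

(** The combinatorial core of the theorem, to which the five conditions are
    compared. A bound suffices, since a cover meets every matching edge. *)
Definition transversal : Prop :=
  forall B, min_vertex_cover C B -> forall i, (#|B :&: m i| <= 1)%N.

Hypothesis mC : forall i, m i \in C.
Hypothesis m_disjoint : forall i j, i != j -> m i :&: m j = finset.set0.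
Hypothesis m_full : (\bigcup_(i < g) m i)%SET = [set: 'I_n]%SET.

Lemma card_matching B : #|B| = (\sum_i #|B :&: m i|)%N.
Proof.
under eq_bigr => i _.
  rewrite -sum1_card (eq_bigl (fun x => (x \in B) && (x \in m i))) => [|x].
    rewrite big_mkcondr; over.
  by rewrite inE.
rewrite exchange_big /= -sum1_card; apply: eq_bigr => x _.
have /bigcupP[i _ xi] : x \in (\bigcup_(i < g) m i)%SET by rewrite m_full inE.
rewrite (bigD1 i) //= xi big1 // => j /m_disjoint/setP/(_ x).
by rewrite !inE xi andbT => ->.
Qed.

Lemma min_cover_meets B i : min_vertex_cover C B -> (0 < #|B :&: m i|)%N.
Proof. by move=> minB; rewrite card_gt0 finset.setIC (min_coverP minB (mC i)). Qed.

Lemma transversal_card : transversal ->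
  forall B, min_vertex_cover C B -> #|B| = g.
Proof.
move=> trC B minB; rewrite card_matching (eq_bigr (fun=> 1%N)) => [|i _].
  by rewrite sum1_card card_ord.
by apply/eqP; rewrite eqn_leq min_cover_meets // andbT trC.
Qed.

(** A cover of at most [g] vertices spends exactly one on each of the [g]
    matching edges. *)
Lemma unmixed_transversal A : vertex_cover C A -> (#|A| <= g)%N ->
  unmixed C -> transversal.
Proof.
move=> covA leA unmC B minB i.
have [B0 minB0 sB0A] := min_vertex_cover_sub covA.
have : (#|B| <= g)%N.
  by rewrite (unmC B B0) //; apply: leq_trans (subset_leq_card sB0A) leA.
rewrite card_matching (bigD1 i) //= leqNgt => leBg; rewrite leqNgt.
apply: contra leBg => gt1.
have : (\sum_(j < g | j != i) 1 <= \sum_(j < g | j != i) #|B :&: m j|)%N.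
  by apply: leq_sum => j _; apply: min_cover_meets.
rewrite sum1_card cardC1 card_ord => le_g.
have := leq_add gt1 le_g.
by apply: leq_trans; case: g i {gt1 le_g} => [[]|k].
Qed.


(** Two cover vertices [x], [y] in one matching edge have private edges [e]
    and [e']; the edge that (b) finds in the union of [e] without [x] and [e']
    without [y] would miss the cover. *)
Lemma exchange_transversal :
  (forall e e' : {set 'I_n}, e \in C -> e' \in C -> e != e' ->
     forall (i : 'I_g) (x y : 'I_n), x != y -> x \in e -> y \in e' ->
       x \in m i -> y \in m i -> contains_edge C ((e :\ x) :|: (e' :\ y))) ->
  transversal.
Proof.
move=> exch B minB i; apply/card_le1_eqP => y x.
rewrite !inE => /andP[yB yi] /andP[xB xi]; apply/eqP; apply: contraT => neq_xy.
have [e eC eB] := min_cover_private_edge minB xB.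
have [e' e'C e'B] := min_cover_private_edge minB yB.
have memB z : z \in B -> ((z \in e) = (z == x)) * ((z \in e') = (z == y)).
  move=> zB; move/setP/(_ z): eB; move/setP/(_ z): e'B.
  by rewrite !inE zB !andbT => -> ->.
have xe : x \in e by rewrite memB.
have ye' : y \in e' by rewrite memB.
have neq_ee' : e != e'.
  by apply: contraNneq neq_xy => ee'; rewrite -(memB x xB).2 -ee'.
have := exch e e' eC e'C neq_ee' i x y neq_xy xe ye' xi yi.
suff dis : [disjoint (e :\ x) :|: (e' :\ y) & B].
  by move/(disjoint_contains_edge minB dis).
rewrite disjoint_sym finset.disjoints_subset; apply/fintype.subsetP => z zB.
by rewrite !inE !memB // !andNb.
Qed.

(** A minimal cover avoiding the set in (b) meets [e] in [x] and [e'] in [y]. *)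
Lemma transversal_exchange : transversal ->
  forall e e' : {set 'I_n}, e \in C -> e' \in C ->
     forall (i : 'I_g) (x y : 'I_n), x != y -> x \in e -> y \in e' ->
       x \in m i -> y \in m i -> contains_edge C ((e :\ x) :|: (e' :\ y)).
Proof.
move=> trC e e' eC e'C i x y neq_xy xe ye' xi yi.
apply: contrapT => /contains_edgeNP[B minB disB].
have onlyB z : z \in B -> (z \in e -> z = x) /\ (z \in e' -> z = y).
  move/(disjointFl disB)/negbT; rewrite !inE negb_or !negb_and !negbK.
  move=> /andP[zx zy]; split=> [ze | ze']; apply/eqP.
    by rewrite ze orbF in zx.
  by rewrite ze' orbF in zy.
have /set0Pn[x'] := min_coverP minB eC; rewrite inE => /andP[x'e x'B].
have /set0Pn[y'] := min_coverP minB e'C; rewrite inE => /andP[y'e' y'B].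
case: (onlyB x' x'B) => /(_ x'e) x'x _; case: (onlyB y' y'B) => _ /(_ y'e') y'y.
move/eqP: neq_xy; apply; have /card_le1_eqP := trC B minB i.
by apply; rewrite inE -?x'x -?y'y ?x'B ?y'B ?x'x ?y'y.
Qed.

(** A minimal cover avoiding the support in (c) meets [e] and [e'] inside [T]
    only, and outside their intersection, so in two vertices of [m i]. *)
Lemma transversal_support : transversal ->
  forall e e' : {set 'I_n}, e \in C -> e' \in C ->
    forall (i : 'I_g) (T : {set 'I_n}), T \subset m i ->
      contains_edge C (msupport (mset e + mset e' - mset T)%MM).
Proof.
move=> trC e e' eC e'C i T sTm.
apply: contrapT => /contains_edgeNP[B minB disB].
have inT z : z \in B -> ((z \in e) + (z \in e') <= (z \in T))%N.
  move/(disjointFl disB).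
  by rewrite inE !(mnmBE, mnmDE, mnmE) subn_gt0 ltnNge => /negbFE.
have /set0Pn[x] := min_coverP minB eC; rewrite inE => /andP[xe xB].
have /set0Pn[y] := min_coverP minB e'C; rewrite inE => /andP[ye' yB].
have := inT x xB; have := inT y yB; rewrite xe ye'.
have le1 : (#|B :&: m i| <= 1)%N by apply: trC.
case yT: (y \in T); case ye: (y \in e) => //.
case xT: (x \in T); case xe': (x \in e') => // _ _.
suff xy : x = y by rewrite -xy xe in ye.
apply: (card_le1_eqP le1); rewrite inE ?xB ?yB /=; exact: (fintype.subsetP sTm).
Qed.

End Matching.

(** * The algebraic conditions *)

Section ColonIdeals.
Variables (K : fieldType) (n : nat) (C : {set {set 'I_n}}).
Variables (g : nat) (m : 'I_g -> {set 'I_n}).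
Implicit Types (A B e : {set 'I_n}).

(** The exponents of [x_e x_e' / gcd(x_e x_e', x_A)] do not change when [A] is
    replaced by its part [T] inside the union of [e] and [e'], and [x_T] does
    divide [x_e x_e']. *)
Lemma support_colon e e' A :
  (forall T : {set 'I_n}, T \subset A -> (mset T <= mset e + mset e')%MM ->
     contains_edge C (msupport (mset e + mset e' - mset T)%MM)) ->
  (ideal_colon (ideal_span [set xset K e * xset K e']) (xset K A)
     `<=` edge_ideal K C)%classic.
Proof.
move=> supC f; rewrite /ideal_colon /= !xsetE -mpolyXD => spanf.
apply/edge_idealP => u uf.
have {spanf} : (mset e + mset e' <= mset A + u)%MM.
  move: spanf; rewrite -(image_set1 (fun s => 'X_[s] : {mpoly K[n]})).
  by move=> /monomial_idealP/(_ _ (msupp_mulX _ uf))[_ ->].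
move=> /mnm_lepP le_Au.
have [| |c cC sc] := supC (A :&: (e :|: e')).
- exact: finset.subsetIl.
- apply/mnm_lepP => i; rewrite mnmDE !mnmE !inE.
  by case: (i \in A); case: (i \in e); case: (i \in e').
exists c => //; apply: fintype.subset_trans sc _; apply/fintype.subsetP => i.
rewrite !inE mnmBE mnmDE; have := le_Au i; rewrite !mnmDE !mnmE !inE.
by case: (i \in A); case: (i \in e); case: (i \in e'); case: (u i).
Qed.

(** Products of two different generators are handled by (d); for a square
    [x_e ^ 2] one factor [x_e] survives, as [x_(m i)] is squarefree. *)
Lemma colon_edge_ideal_sum :
  finset.set0 \notin C -> (\bigcup_(i < g) m i)%SET = [set: 'I_n]%SET ->
  (forall i, m i \in C) ->
  (forall e e' : {set 'I_n}, e \in C -> e' \in C -> e != e' ->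
     forall i : 'I_g,
       (ideal_colon (ideal_span [set xset K e * xset K e'])
          (xset K (m i)) `<=` edge_ideal K C)%classic) ->
  edge_ideal K C = ideal_sum (fun i : 'I_g =>
    ideal_colon (ideal_mul (edge_ideal K C) (edge_ideal K C)) (xset K (m i))).
Proof.
move=> C0 m_full mC colC; apply/seteqP; split=> f.
  apply: ideal_span_sub f => [|f f' [h [hJ ->]] [h' [h'J ->]]|a _ [e eC ->]].
  - exists (fun=> 0); rewrite big1 //; split=> // i.
    by rewrite /ideal_colon /= mul0r; apply: ideal_span0.
  - exists (fun i => h i + h' i); rewrite big_split; split=> // i.
    by rewrite /ideal_colon /= mulrDl; apply: ideal_spanD; [apply: hJ|apply: h'J].
  have /set0Pn[x _] : e != finset.set0 by apply: contraNneq C0 => <-.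
  have /bigcupP[i _ _] : x \in (\bigcup_(i < g) m i)%SET by rewrite m_full inE.
  apply: (@ideal_sum_gen _ _ _ i) => [j|]; rewrite /ideal_colon /=.
    by rewrite mul0r; apply: ideal_span0.
  rewrite -mulrA; apply/ideal_spanMl/ideal_span_gen.
  exists (xset K e), (xset K (m i)); split=> //; apply: ideal_span_gen.
    by exists e.
  by exists (m i); first exact: mC.
move=> [h [hJ ->]]; apply: (big_ind (edge_ideal K C)).
- exact: ideal_span0.
- by move=> p q; apply: ideal_spanD.
move=> i _; apply/edge_idealP => u uh.
move/edge_ideal_sqrP: (hJ i); rewrite xsetE.
move=> /(_ _ (msupp_mulX _ uh))[e [e' [eC e'C le_u]]].
have [ee'|neq_ee'] := eqVneq e e'; last first.
  apply/(edge_idealX K)/(colC e e' eC e'C neq_ee' i).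
  rewrite /ideal_colon /= !xsetE -!mpolyXD; apply/principal_monomialX.
  by rewrite [(u + _)%MM]addmC.
exists e => //; rewrite -mset_le; apply/mnm_lepP => j.
move/mnm_lepP/(_ j): le_u; rewrite -ee' !mnmDE !mnmE.
by case: (j \in e); case: (j \in m i); case: (u j).
Qed.

(** If a minimal cover met [m i] in two vertices with private edges [e] and
    [e'], then [x_e x_e'] with [x_(m i)] cancelled would lie in the colon ideal
    although its support misses the cover. *)
Lemma colon_sum_transversal :
  edge_ideal K C = ideal_sum (fun i : 'I_g =>
    ideal_colon (ideal_mul (edge_ideal K C) (edge_ideal K C)) (xset K (m i))) ->
  transversal C m.
Proof.
move=> eqI B minB i; apply/card_le1_eqP => y x; rewrite !inE.
move=> /andP[yB yi] /andP[xB xi]; apply/eqP; apply: contraT => neq_xy.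
have [e eC eB] := min_cover_private_edge minB xB.
have [e' e'C e'B] := min_cover_private_edge minB yB.
pose u := (mset e + mset e' - mset (m i))%MM.
have : edge_ideal K C 'X_[u].
  rewrite eqI; apply: (@ideal_sum_gen _ _ _ i) => [j|]; rewrite /ideal_colon /=.
    by rewrite mul0r; apply: ideal_span0.
  rewrite xsetE -mpolyXD; apply/edge_ideal_sqrP => v.
  rewrite msuppX inE => /eqP->; exists e, e'; split=> //.
  by apply/mnm_lepP => j; rewrite /u !(mnmDE, mnmBE) [leqRHS]addnC -leq_subLR.
move/edge_idealX => edge_u.
suff /(disjoint_contains_edge minB)/(_ edge_u) : [disjoint msupport u & B] by [].
rewrite disjoint_sym finset.disjoints_subset; apply/fintype.subsetP => z zB.
rewrite !inE mnmBE mnmDE !mnmE.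
move/setP/(_ z): eB; move/setP/(_ z): e'B; rewrite !inE zB !andbT => -> ->.
have [->|_] := eqVneq z x; first by rewrite xi (negbTE neq_xy).
by have [->|_] := eqVneq z y; rewrite ?yi.
Qed.

End ColonIdeals.

Theorem theorem2p9 (K : fieldType) (n : nat) (C : {set {set 'I_n}})
    (g : nat) (m : 'I_g -> {set 'I_n})
    (clutC : is_clutter C) (konig : konig_perfect_matching K C m) :
  let I := edge_ideal K C in
  [<-> (* a *) unmixed C;
       (* b *) forall e e' : {set 'I_n}, e \in C -> e' \in C -> e != e' ->
         forall (i : 'I_g) (x y : 'I_n), x != y -> x \in e -> y \in e' ->
           x \in m i -> y \in m i ->
           contains_edge C ((e :\ x) :|: (e' :\ y));
       (* c *) forall e e' : {set 'I_n}, e \in C -> e' \in C -> e != e' ->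
         forall (i : 'I_g) (T : {set 'I_n}), T \subset m i ->
           (mset T <= mset e + mset e')%MM ->
           contains_edge C (msupport (mset e + mset e' - mset T)%MM);
       (* d *) forall e e' : {set 'I_n}, e \in C -> e' \in C -> e != e' ->
         forall i : 'I_g,
           (ideal_colon (ideal_span [set xset K e * xset K e'])
              (xset K (m i)) `<=` I)%classic;
       (* e *) I = ideal_sum (fun i : 'I_g =>
                 ideal_colon (ideal_mul I I) (xset K (m i)))].
Proof.
move=> I; have [mC m_disjoint m_full heightI] := konig.
have [A covA leA] := height_vertex_cover heightI.
have C0 : finset.set0 \notin C.
  by apply/negP => /(forall_inP covA); rewrite finset.set0I eqxx.
tfae.
- move=> /(unmixed_transversal mC m_disjoint m_full covA leA) trC e e' eC e'C _.
  exact: (transversal_exchange trC eC e'C).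
- move=> /exchange_transversal trC e e' eC e'C _ i T sTm _.
  exact: (transversal_support trC eC e'C sTm).
- move=> supC e e' eC e'C neq_ee' i.
  exact/support_colon/(supC e e' eC e'C neq_ee').
- exact: colon_edge_ideal_sum.
move=> /colon_sum_transversal trC B B' minB minB'.
by rewrite !(transversal_card mC m_disjoint m_full trC).
Qed.
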